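(* Let $K\subset\mathbb{R}^n$ be a closed convex set and $U\subset\mathbb{R}^n$ an affine subspace with $K\cap U\neq\varnothing$, and let $z\in U$ be given. For $w\in\mathbb{R}^n$ write $C(w):=\operatorname{circumcenter}\{w,R_K(w),R_UR_K(w)\}$ (when well-defined). Then the sequence $(C^k(z))_{k\in\mathbb{N}}$ is well-defined, contained in $U$, and converges to a point in $K\cap U$.
   Context: $\mathbb{R}^n$ carries the Euclidean norm $\|\cdot\|$. For a nonempty closed convex set $\Omega\subset\mathbb{R}^n$, $P_\Omega$ is the orthogonal projection onto $\Omega$ and $R_\Omega:=2P_\Omega-\operatorname{Id}$ is the reflection operator, where $\operatorname{Id}$ is the identity. For points $a,b,c\in\mathbb{R}^n$ (not necessarily distinct), $\operatorname{circumcenter}\{a,b,c\}$ is the point $p$ such that (i) $\|a-p\|=\|b-p\|=\|c-p\|$ and (ii) $p\in\operatorname{aff}\{a,b,c\}$, the affine hull of the three points; it is well-defined if such a point exists (it is then unique). $C^k$ denotes the $k$-fold iterate of $C$, with $C^0(z)=z$. *)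

(* Defs.v *)
From HB Require Import structures.
From mathcomp Require Import all_boot all_order all_algebra.
From mathcomp Require Import all_classical all_reals all_analysis.
From mathcomp Require Import ring lra.

Set Implicit Arguments.
Unset Strict Implicit.
Unset Printing Implicit Defensive.

Import Order.TTheory GRing.Theory Num.Theory.
Import numFieldNormedType.Exports.

Local Open Scope classical_set_scope.
Local Open Scope ring_scope.

(* R^n is ['rV[R]_n].  The library norm [`|x|] on it is the max norm, hence this one.  The
   library topology on ['rV[R]_n] (used for [closed] and [-->]) is the product
   topology, i.e. the usual topology of R^n. *)
Definition enorm (R : realType) (n : nat) (x : 'rV[R]_n) : R :=
  Num.sqrt (\sum_(i < n) x 0 i ^+ 2).

(* The empty set is affine for this definition. *)
Definition affine_set (R : realType) (n : nat) (A : set 'rV[R]_n) : Prop :=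
  forall (x y : 'rV[R]_n) (t : R), A x -> A y -> A ((1 - t) *: x + t *: y).

Definition aff (R : realType) (n : nat) (A : set 'rV[R]_n) : set 'rV[R]_n :=
  [set x | forall B : set 'rV[R]_n, affine_set B -> A `<=` B -> B x].

Definition is_proj (R : realType) (n : nat) (A : set 'rV[R]_n)
    (x p : 'rV[R]_n) : Prop :=
  A p /\ forall q : 'rV[R]_n, A q -> enorm (x - p) <= enorm (x - q).

(* Meaningful when [A] is nonempty, closed and convex; the value is 0 when
   there is no nearest point. *)
Definition proj (R : realType) (n : nat) (A : set 'rV[R]_n)
    (x : 'rV[R]_n) : 'rV[R]_n :=
  xget 0 [set p | is_proj A x p].

Definition reflection (R : realType) (n : nat) (A : set 'rV[R]_n)
    (x : 'rV[R]_n) : 'rV[R]_n :=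
  2 *: proj A x - x.

Definition is_circumcenter (R : realType) (n : nat) (a b c p : 'rV[R]_n) : Prop :=
  [/\ enorm (a - p) = enorm (b - p),
      enorm (b - p) = enorm (c - p) &
      aff [set a; b; c] p].

(* The circumcenter is a partial operation: [circumcenter a b c] has the junk
   value 0 unless [circumcenter_defined a b c]. *)
Definition circumcenter_defined (R : realType) (n : nat)
    (a b c : 'rV[R]_n) : Prop :=
  exists p : 'rV[R]_n, is_circumcenter a b c p.

Definition circumcenter (R : realType) (n : nat) (a b c : 'rV[R]_n) : 'rV[R]_n :=
  xget 0 [set p | is_circumcenter a b c p].

Definition crm (R : realType) (n : nat) (K U : set 'rV[R]_n)
    (w : 'rV[R]_n) : 'rV[R]_n :=
  circumcenter w (reflection K w) (reflection U (reflection K w)).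

Definition crm_defined (R : realType) (n : nat) (K U : set 'rV[R]_n)
    (w : 'rV[R]_n) : Prop :=
  circumcenter_defined w (reflection K w) (reflection U (reflection K w)).

Lemma enorm_sqr (R : realType) (n : nat) (x : 'rV[R]_n) :
  enorm x ^+ 2 = \sum_(i < n) x 0 i ^+ 2.
Proof. by rewrite sqr_sqrtr// sumr_ge0// => i _; exact: sqr_ge0. Qed.

Lemma enorm_eq0 (R : realType) (n : nat) (x : 'rV[R]_n) :
  enorm x ^+ 2 = 0 -> x = 0.
Proof.
rewrite enorm_sqr => /eqP; rewrite psumr_eq0; last by move=> i _; exact: sqr_ge0.
move=> /allP x0; apply/rowP => i; rewrite mxE; apply/eqP.
by rewrite -sqrf_eq0; apply: x0; rewrite mem_index_enum.
Qed.

(* The set where [`|x - p|^2 - `|x - q|^2 = k] is affine; it contains a, b, c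
   for a suitable k, hence p and q. *)
Lemma is_circumcenter_uniq (R : realType) (n : nat) (a b c p q : 'rV[R]_n) :
  is_circumcenter a b c p -> is_circumcenter a b c q -> p = q.
Proof.
move=> [abp bcp affp] [abq bcq affq].
pose f (x : 'rV[R]_n) := enorm (x - p) ^+ 2 - enorm (x - q) ^+ 2.
have fE x : f x = \sum_(i < n) (2 * x 0 i - p 0 i - q 0 i) * (q 0 i - p 0 i).
  rewrite /f !enorm_sqr -sumrB; apply: eq_bigr => i _; rewrite !mxE; ring.
have faff : affine_set [set x | f x = f a].
  move=> x y t /= fx fy.
  have -> : f ((1 - t) *: x + t *: y) = (1 - t) * f x + t * f y.
    rewrite !fE !mulr_sumr -big_split /=; apply: eq_bigr => i _; rewrite !mxE.
    ring.
  by rewrite fx fy; ring.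
have sub : [set a; b; c] `<=` [set x | f x = f a].
  move=> x [[->//|->]|->] /=; first by rewrite /f -abp -abq.
  by rewrite /f -bcp -bcq -abp -abq.
have := affp _ faff sub; have := affq _ faff sub; rewrite /= => <-.
have e0 : enorm (0 : 'rV[R]_n) = 0.
  by rewrite /enorm big1 ?sqrtr0// => i _; rewrite mxE expr0n.
have eN : enorm (p - q) ^+ 2 = enorm (q - p) ^+ 2.
  by rewrite !enorm_sqr; apply: eq_bigr => i _; rewrite !mxE; ring.
rewrite /f !subrr e0 eN expr0n /= => H.
have /enorm_eq0/eqP : enorm (q - p) ^+ 2 = 0 by lra.
by rewrite subr_eq0 => /eqP.
Qed.

(* Main.v *)
Require Import Defs.
From mathcomp Require Import all_boot all_order all_algebra.
From mathcomp Require Import all_classical all_reals all_analysis.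
From mathcomp Require Import ring lra.

Import Order.TTheory GRing.Theory Num.Theory.
Import numFieldNormedType.Exports.

Local Open Scope classical_set_scope.
Local Open Scope ring_scope.

(** The circumcentre step is a projection step in disguise.  Let [w] be in [U],
    [p] its projection onto [K], [r = 2 p - w] its reflection and [q] the
    projection of [r] onto [U], so that [2 q - r] is the reflection of [r].
    The points equidistant from [r] and [2 q - r] form a hyperplane containing
    [U], which meets the affine hull of the three points in the line [w q] (if
    [r] is in [U], this line is the whole affine hull); the points equidistant from [w] and [r] form the
    hyperplane [H] through [p] orthogonal to [p - w].  Hence the circumcentre
    [c] is the point of the line [w q] that lies on [H], namely
    [w + t (q - w)] with [t = 2 |p - w|^2 / |q - w|^2]
    ([is_circumcenter_reflections]).  The degenerate case [q = w] forces
    [p = w], because [K] meets [U]; then all the points coincide.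

    The hyperplane [H] separates [w] from [K], and [c] is the nearest point to
    [w] of its part in [U].  So for every [y] in [K `&` U],
    [|c - y|^2 + |w - c|^2 <= |w - y|^2], and moreover [|w - p| <= |w - c|],
    since [p] is the nearest point to [w] of [H] ([crm_spec]).

    The iterates [u k] are thus Fejer monotone with respect to [K `&` U], and
    the distance from [u k] to [K] tends to 0, since its square is bounded by a
    difference of consecutive terms of the nonincreasing sequence
    [|u k - y|^2 >= 0] ([antitone_gap]).  A cluster point of the bounded
    sequence [u] then belongs to [K `&` U], as both sets are closed
    ([affine_set_closed] for [U]), and a Fejer monotone sequence converges to
    any of its cluster points that belongs to the target set ([fejer_cvg]). *)

(** * Inner product and squared norm *)

Definition dot {R : realType} {n : nat} (x y : 'rV[R]_n) : R :=
  \sum_(i < n) x 0 i * y 0 i.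

(** Every metric estimate below is polynomial in inner products, so it is stated
    with squared norms, which avoids the square root of [enorm]. *)
Definition sqn {R : realType} {n : nat} (x : 'rV[R]_n) : R := dot x x.

Section Euclidean.
Context (R : realType) (n : nat).
Implicit Types (x y w : 'rV[R]_n) (t : R).
Set Implicit Arguments.
Unset Strict Implicit.

Lemma dotC x y : dot x y = dot y x.
Proof. by apply: eq_bigr => i _; rewrite mulrC. Qed.

Lemma dotDl x y w : dot (x + y) w = dot x w + dot y w.
Proof. by rewrite -big_split; apply: eq_bigr => i _; rewrite mxE mulrDl. Qed.

Lemma dotZl t x y : dot (t *: x) y = t * dot x y.
Proof. by rewrite mulr_sumr; apply: eq_bigr => i _; rewrite mxE mulrA. Qed.

Lemma dotNl x y : dot (- x) y = - dot x y.
Proof. by rewrite -scaleN1r dotZl mulN1r. Qed.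

Lemma dotDr x y w : dot w (x + y) = dot w x + dot w y.
Proof. by rewrite dotC dotDl !(dotC w). Qed.

Lemma dotZr t x y : dot x (t *: y) = t * dot x y.
Proof. by rewrite dotC dotZl dotC. Qed.

Lemma dotNr x y : dot y (- x) = - dot y x.
Proof. by rewrite dotC dotNl dotC. Qed.

Definition dotE := (dotDl, dotDr, dotZl, dotZr, dotNl, dotNr).

Lemma sqn_ge0 x : 0 <= sqn x.
Proof. by apply: sumr_ge0 => i _; exact: sqr_ge0. Qed.

Lemma enormE x : enorm x = Num.sqrt (sqn x).
Proof. by []. Qed.

Lemma enorm_le x y : (enorm x <= enorm y) = (sqn x <= sqn y).
Proof. by rewrite !enormE ler_sqrt ?sqn_ge0. Qed.

Lemma sqn_eq0 x : sqn x = 0 -> x = 0.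
Proof. by move=> x0; apply: enorm_eq0; rewrite enormE x0 sqrtr0 expr0n. Qed.

Lemma coord_sqn x (i : 'I_n) : x 0 i ^+ 2 <= sqn x.
Proof.
rewrite /sqn /dot (bigD1 i)//= -expr2 lerDl sumr_ge0// => j _; exact: sqr_ge0.
Qed.

Lemma sqn_sub x y : sqn (x - y) = sqn (y - x).
Proof. by rewrite -opprB /sqn dotNl dotNr opprK. Qed.

Lemma sqn_subZ t x y :
  sqn (x - t *: y) = sqn x - 2 * t * dot y x + t ^+ 2 * sqn y.
Proof. by rewrite /sqn !dotE (dotC x y); ring. Qed.

Lemma sqn_sub_add x y : sqn (x - y) - sqn (x + y) = - (4 * dot x y).
Proof. by rewrite /sqn !dotE (dotC y x); ring. Qed.

(** A substitute for the triangle inequality, by the parallelogram law; the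
    factor 2 is harmless in limit arguments. *)
Lemma sqn_triangle x y : sqn (x + y) <= 2 * sqn x + 2 * sqn y.
Proof.
have := sqn_ge0 (x - y); rewrite /sqn !dotE (dotC y x); lra.
Qed.

(** * Topology of the space in terms of squared norms *)

Lemma sum_continuous (T : topologicalType) (m : nat) (f : 'I_m -> T -> R) :
  (forall i, continuous (f i)) -> continuous (fun u => \sum_(i < m) f i u).
Proof.
move=> fc; rewrite -fct_sumE; elim/big_ind: _ => [u|g h gc hc u|i _].
- exact: (@cst_continuous _ _ (0 : R)).
- exact: (continuousD (gc u) (hc u)).
- exact: fc.
Qed.

Lemma coord_sub_continuous x (i : 'I_n) (y : 'rV[R]_n) :
  {for y, continuous (fun v : 'rV[R]_n => v 0 i - x 0 i)}.
Proof.
exact: (continuousB (@coord_continuous R 1 n 0 i y)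
  (@cst_continuous _ _ (x 0 i) y)).
Qed.

Lemma sqn_sub_continuous x : continuous (fun y : 'rV[R]_n => sqn (y - x)).
Proof.
apply: sum_continuous => i y.
rewrite [X in continuous_at _ X](_ : _ =
    fun v : 'rV[R]_n => (v 0 i - x 0 i) * (v 0 i - x 0 i)); last first.
  by apply/funext => v; rewrite !mxE.
have c := @coord_sub_continuous x i y; exact: (continuousM c c).
Qed.

Lemma nbhs_sqn x (A : set 'rV[R]_n) : nbhs x A ->
  exists2 e, 0 < e & forall y, sqn (y - x) < e -> A y.
Proof.
move=> /nbhs_ballP[e /= e0 eA]; exists (e ^+ 2); first by rewrite exprn_gt0.
move=> y ye; apply: eA; split => // i j; rewrite ord1 /ball/=.
rewrite distrC -(ltr_pXn2r (n := 2)) ?nnegrE ?(ltW e0)//.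
rewrite real_normK ?num_real//; apply: le_lt_trans ye.
by have := coord_sqn (y - x) j; rewrite !mxE.
Qed.

Lemma sqn_nbhs x e : 0 < e -> nbhs x [set y | sqn (y - x) < e].
Proof.
move=> e0; suff: nbhs (sqn (x - x)) [set r | r < e] by exact: sqn_sub_continuous.
by apply: lt_nbhsl; rewrite subrr /sqn -(scale0r 0) dotZl mul0r.
Qed.

Lemma closed_sqn (A : set 'rV[R]_n) x : closed A ->
  (forall e, 0 < e -> exists2 a, A a & sqn (a - x) < e) -> A x.
Proof.
move=> Acl Ax; apply: Acl => B /nbhs_sqn[e e0 eB].
by have [a Aa ae] := Ax _ e0; exists a; split => //; exact: eB.
Qed.

(** The ball is a closed subset of a product of segments; the half-length
    [1 + r] is enough since [|s| <= 1 + s ^+ 2]. *)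
Lemma compact_sqn_ball x r : compact [set y | sqn (y - x) <= r].
Proof.
pose box := [set v : 'rV[R]_n | forall i,
  [set` `[x 0 i - (1 + r), x 0 i + (1 + r)]] (v ord0 i)].
have box_compact : compact box.
  apply: (@rV_compact R n (fun i => `[x 0 i - (1 + r), x 0 i + (1 + r)]%classic)).
  by move=> i; exact: segment_compact.
apply: (@subclosed_compact _ _ box) => //.
- apply: (@preimage_closed _ _ (fun y : 'rV[R]_n => sqn (y - x)) [set s | s <= r]).
    by move=> y _; exact: sqn_sub_continuous.
  exact: closed_le.
- move=> y /= yr i; rewrite /= in_itv /=.
  have := le_trans (coord_sqn (y - x) i) yr; rewrite !mxE.
  move: (y 0 i) (x 0 i) => a b abr.
  have := sqr_ge0 (a - b - 1); have := sqr_ge0 (a - b + 1).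
  by move=> *; apply/andP; split; nra.
Qed.

(** * Projections onto closed convex sets and affine subspaces *)

Lemma is_proj_proj (A : set 'rV[R]_n) x : closed A -> A !=set0 ->
  is_proj A x (Defs.proj A x).
Proof.
move=> Acl [a Aa]; apply: xgetPex.
(* Only the points at least as close to [x] as [a] compete, and they form a
   compact set. *)
pose B := A `&` [set y | sqn (y - x) <= sqn (a - x)].
have Ba : B a by split => /=.
have Bcpt : compact B.
  by rewrite /B setIC; apply: compact_closedI => //; exact: compact_sqn_ball.
have [|p /set_mem[Ap pa] pmin] :=
    @EVT_min_rV R n (fun y => sqn (y - x)) B (ex_intro _ a Ba) Bcpt.
  by apply: continuous_subspaceT; exact: sqn_sub_continuous.
exists p; split=> // q Aq; rewrite enorm_le.
rewrite (sqn_sub x p) (sqn_sub x q).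
have [qa|/ltW aq] := leP (sqn (q - x)) (sqn (a - x)).
  by apply: pmin; apply/mem_set.
exact: le_trans aq.
Qed.

(** Moving from [p] towards [y] by a fraction [t] changes the squared distance
    to [x] by [t ^+ 2 * b - 2 * t * a], where [a] is the inner product and [b]
    the squared norm of [y - p]: if [a] were positive, a small [t] would
    contradict the minimality of [p]. *)
Lemma is_proj_convex (A : set 'rV[R]_n) x p y : @convex_set R 'rV[R]_n A ->
  is_proj A x p -> A y -> dot (y - p) (x - p) <= 0.
Proof.
move=> Acvx [Ap pmin] Ay; rewrite leNgt; apply/negP => a0.
set a := dot _ _ in a0.
set b := sqn (y - p); have b0 : 0 <= b by exact: sqn_ge0.
have ab0 : 0 < a + b by lra.
(* With this [t], [t <= 1] and [t * b < 2 * a]; it is also meaningful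
   when [b = 0]. *)
pose t := a / (a + b).
have t0 : 0 < t by rewrite divr_gt0.
have t1 : t <= 1 by rewrite ler_pdivrMr// mul1r lerDl.
have tE : t * (a + b) = a by rewrite /t divfK// gt_eqF.
have Aq : A (t *: y + (1 - t) *: p).
  have := Acvx y p (@Itv01 R t (ltW t0) t1) (mem_set Ay) (mem_set Ap).
  by rewrite inE.
have := pmin _ Aq; rewrite enorm_le.
have -> : x - (t *: y + (1 - t) *: p) = (x - p) - t *: (y - p).
  by apply/rowP => i; rewrite !mxE; ring.
rewrite sqn_subZ -/a -/b; nra.
Qed.

(** [x + t (y1 - y2)] is on the line from [y2] through the midpoint of [x] and
    of the point [y2 + t (y1 - y2)]. *)
Lemma affine_setD (A : set 'rV[R]_n) x y1 y2 t : affine_set A ->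
  A x -> A y1 -> A y2 -> A (x + t *: (y1 - y2)).
Proof.
move=> Aaff Ax Ay1 Ay2.
have Am := Aaff _ _ 2^-1 (Aaff _ _ t Ay2 Ay1) Ax.
have := Aaff _ _ 2 Ay2 Am; congr A.
by apply/rowP => i; rewrite !mxE; field.
Qed.

Lemma affine_set_convex (A : set 'rV[R]_n) : affine_set A ->
  @convex_set R 'rV[R]_n A.
Proof.
move=> Aaff x y t /set_mem Ax /set_mem Ay; apply/mem_set.
have := Aaff _ _ t%:num Ay Ax; congr A.
by rewrite addrC.
Qed.

(** The inequality for convex sets holds in the direction [y1 - y2] and in the
    opposite one. *)
Lemma is_proj_affine (A : set 'rV[R]_n) x p y1 y2 : affine_set A ->
  is_proj A x p -> A y1 -> A y2 -> dot (y1 - y2) (x - p) = 0.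
Proof.
move=> Aaff pA Ay1 Ay2; have [Ap _] := pA.
have le0 t : t * dot (y1 - y2) (x - p) <= 0.
  have := is_proj_convex (affine_set_convex Aaff) pA
    (affine_setD t Aaff Ap Ay1 Ay2).
  by rewrite (addrC p) addrK dotZl.
by have := le0 1; have := le0 (-1); lra.
Qed.

(** Take for [M] a matrix of maximal rank among those whose rows are directions
    of [A]: adjoining a direction outside its row space would increase the
    rank. *)
Lemma affine_set_subspace (A : set 'rV[R]_n) a : affine_set A -> A a ->
  exists M : 'M[R]_n, forall x, A x <-> (x - a <= M)%MS.
Proof.
move=> Aaff Aa.
have comb m (M : 'M[R]_(m, n)) v : (forall i, A (a + row i M)) ->
    (v <= M)%MS -> A (a + v).
  move=> AM /submxP[c ->]; rewrite mulmx_sum_row.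
  elim/big_ind: _ => [|u w Au Aw|i _]; first by rewrite addr0.
    have := affine_setD 1 Aaff Au Aw Aa.
    by rewrite scale1r (addrC a w) addrK addrA.
  by have := affine_setD (c 0 i) Aaff Aa (AM i) Aa; rewrite (addrC a (row _ _)) addrK.
pose rk r := `[< exists2 M : 'M[R]_n, (forall i, A (a + row i M)) & \rank M = r >].
have rk0 : exists r, rk r.
  by exists 0%N; apply/asboolP; exists 0 => [i|]; rewrite ?mxrank0 ?row0 ?addr0.
have rkn r : rk r -> (r <= n)%N by move=> /asboolP[M _ <-]; exact: rank_leq_row.
have [_ /asboolP[M AM <-] Mmax] := ex_maxnP rk0 rkn.
exists M => x; split; last by move=> /(comb _ _ _ AM); rewrite addrC subrK.
move=> Ax; apply: contrapT => /negP xM.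
pose N := genmx (M + (x - a))%MS.
have AN i : A (a + row i N).
  have /sub_addsmxP[[c d] /= ->] : (row i N <= M + (x - a))%MS.
    by apply: submx_trans (row_sub i N) _; rewrite genmxE.
  have Ac : A (a + c *m M) by apply: comb AM _; exact: submxMl.
  have := affine_setD (d 0 0) Aaff Ac Ax Aa; rewrite -addrA; congr (A (_ + (_ + _))).
  by rewrite [d in RHS]mx11_scalar mul_scalar_mx.
have /Mmax : rk (\rank N) by apply/asboolP; exists N.
rewrite leqNgt => /negP; apply; apply: rank_ltmx.
rewrite ltmxE !genmxE addsmxSl /= ; apply: (contraNN _ xM) => NM.
exact: submx_trans (addsmxSr _ _) NM.
Qed.

(** An affine set is defined by finitely many linear equations, given by the
    columns of [cokermx M], for [M] spanning its directions. *)
Lemma affine_set_closed (A : set 'rV[R]_n) : affine_set A -> closed A.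
Proof.
move=> Aaff x Ax; have [a [Aa _]] := Ax _ filterT.
have [M AM] := affine_set_subspace Aaff Aa.
pose f j (y : 'rV[R]_n) := \sum_i (y 0 i - a 0 i) * cokermx M i j.
have AE : A = \bigcap_j (f j @^-1` [set 0]).
  apply/seteqP; split => y; rewrite AM submxE.
    move=> /eqP/matrixP Ay j _; have := Ay 0 j; rewrite !mxE => <-.
    by apply: eq_bigr => i _; rewrite !mxE.
  move=> Ay; apply/eqP/rowP => j; rewrite [RHS]mxE -(Ay j)// mxE.
  by apply: eq_bigr => i _; rewrite !mxE.
move: Ax; rewrite AE; apply: closed_bigI => j _; apply: preimage_closed.
  move=> y _; apply: sum_continuous => i {}y.
  have c := @coord_sub_continuous a i y.
  exact: (continuousM c (@cst_continuous _ _ (cokermx M i j) y)).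
exact: closed_eq.
Qed.

(** * The circumcentre of a point and its two successive reflections *)

(** The hypothesis [dot (q - w) (r - q) = 0] is what the projection [q] of [r]
    onto an affine set containing [w] satisfies.  It gives
    [2 * dot (q - w) (p - w) = sqn (q - w)], and [t] is then the solution of
    [dot (p - c) (p - w) = 0], which says that [c] is equidistant from [w] and
    [r], as [p] is their midpoint.  Every point of the line [w q] is equidistant
    from [r] and [2 *: q - r], since [q] is their midpoint and that line is
    orthogonal to [r - q].  When [q = w], the division by zero gives [t = 0],
    so [c = w], which is the right value. *)
Lemma is_circumcenter_reflections (w p q : 'rV[R]_n) (t := 2 * sqn (p - w) / sqn (q - w))
    (c := (1 - t) *: w + t *: q) (r := 2 *: p - w) :
  dot (q - w) (r - q) = 0 -> (q = w -> p = w) ->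
  is_circumcenter w r (2 *: q - r) c /\ dot (p - c) (p - w) = 0.
Proof.
move=> qr qw.
have pc : dot (p - c) (p - w) = 0.
  have -> : p - c = (p - w) - t *: (q - w) by apply/rowP => i; rewrite !mxE; ring.
  have [q0|q0] := eqVneq (sqn (q - w)) 0.
    move: q0 => /sqn_eq0/eqP; rewrite subr_eq0 => /eqP/qw ->.
    by rewrite subrr -(scale0r 0) dotZr mul0r.
  have tE : t * sqn (q - w) = 2 * sqn (p - w) by rewrite /t divfK.
  have rE : r - q = 2 *: (p - w) - (q - w) by apply/rowP => i; rewrite !mxE; ring.
  rewrite rE dotDr dotNr dotZr in qr; rewrite dotDl dotNl dotZl.
  have dE : sqn (q - w) = 2 * dot (q - w) (p - w) by rewrite /sqn; lra.
  by move: tE; rewrite dE /sqn; lra.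
split=> //; split.
- congr Num.sqrt; apply/eqP; rewrite -subr_eq0; apply/eqP.
  rewrite -[X in X = _]/(sqn (w - c) - sqn (r - c)).
  have -> : w - c = (p - c) - (p - w) by apply/rowP => i; rewrite !mxE; ring.
  have -> : r - c = (p - c) + (p - w) by apply/rowP => i; rewrite !mxE; ring.
  by rewrite sqn_sub_add pc mulr0 oppr0.
- congr Num.sqrt; apply/eqP; rewrite -subr_eq0; apply/eqP.
  rewrite -[X in X = _]/(sqn (r - c) - sqn (2 *: q - r - c)).
  have -> : r - c = (1 - t) *: (q - w) + (r - q) by apply/rowP => i; rewrite !mxE; ring.
  have -> : 2 *: q - r - c = (1 - t) *: (q - w) - (r - q).
    by apply/rowP => i; rewrite !mxE; ring.
  by rewrite -[LHS]opprB sqn_sub_add dotZl qr !mulr0 !oppr0.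
- move=> B Baff sB.
  rewrite /c; have -> : q = (1 - 2^-1) *: r + 2^-1 *: (2 *: q - r).
    by apply/rowP => i; rewrite !mxE; field.
  by apply: (Baff); [|apply: (Baff)]; apply: sB; [left; left|left; right|right].
Qed.

(** * Fejer monotone sequences *)

Lemma compact_seq_cluster (C : set 'rV[R]_n) (u : nat -> 'rV[R]_n) :
  compact C -> (forall k, C (u k)) ->
  exists x, forall e N, 0 < e -> exists2 k, (N <= k)%N & sqn (u k - x) < e.
Proof.
move=> Ccpt Cu; have uC : (u @ \oo) C by exists 0%N => // k _; exact: Cu.
have [x [_ xu]] := Ccpt (u @ \oo) _ uC.
exists x => e N e0.
have uN : (u @ \oo) (u @` [set k | (N <= k)%N]) by exists N => // k; exists k.
by have [_ [[k Nk <-] ke]] := xu _ _ uN (sqn_nbhs _ e0); exists k.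
Qed.

Lemma sqn_cvg (u : nat -> 'rV[R]_n) x :
  (forall e, 0 < e -> exists N, forall k, (N <= k)%N -> sqn (u k - x) < e) ->
  u @ \oo --> x.
Proof.
move=> ux A /nbhs_sqn[e e0 eA]; have [N uN] := ux _ e0.
by exists N => // k /= /uN/eA.
Qed.

(** From an index [N] at which [a] is within [e] of its infimum, all
    the later values stay in an interval of length less than [e]. *)
Lemma antitone_gap (a : nat -> R) (e : R) : 0 < e -> (forall k, 0 <= a k) ->
  (forall k, a k.+1 <= a k) -> exists N, forall k, (N <= k)%N -> a k - a k.+1 < e.
Proof.
move=> e0 a0 adec.
have lba : has_inf (range a).
  by split; [exists (a 0%N); exists 0%N | exists 0 => _ [k _ <-]].
have [_ [N _ <-] aN] := inf_adherent e0 lba; exists N => k Nk.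
have akN : a k <= a N.
  rewrite -(subnKC Nk); elim: (k - N)%N => [|j]; first by rewrite addn0.
  by rewrite addnS; exact/le_trans/adec.
have : inf (range a) <= a k.+1 by apply: (ge_inf lba.2); exists k.+1.
lra.
Qed.

(** The distance to the cluster point [x] does not increase, so it stays below
    any bound that it reaches once. *)
Lemma fejer_cvg (S : set 'rV[R]_n) (u : nat -> 'rV[R]_n) x :
  (forall y k, S y -> sqn (u k.+1 - y) <= sqn (u k - y)) -> S x ->
  (forall e N, 0 < e -> exists2 k, (N <= k)%N & sqn (u k - x) < e) ->
  u @ \oo --> x.
Proof.
move=> uS Sx ux; apply: sqn_cvg => e e0.
have [N _ uN] := ux e 0%N e0; exists N => k Nk; apply: le_lt_trans uN.
rewrite -(subnKC Nk); elim: (k - N)%N => [|j IH]; first by rewrite addn0.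
by rewrite addnS; apply: le_trans (uS _ _ Sx) IH.
Qed.

(** * The circumcentred-reflection iteration *)

Section CRM.
Context (K U : set 'rV[R]_n).
Context (K_closed : closed K) (K_convex : @convex_set R 'rV[R]_n K).
Context (U_affine : affine_set U) (KU_neq0 : K `&` U !=set0).

(** One step is well defined, stays in [U], and moves [w] by at least its
    distance to [K], while the squared distance to each common point drops by at
    least the squared length of the move.  Both estimates come from the new
    point being in the hyperplane through the projection [p] of [w] onto [K],
    orthogonal to [p - w], which separates [w] from [K]. *)
Lemma crm_spec w : U w ->
  [/\ crm_defined K U w, U (crm K U w),
      sqn (w - Defs.proj K w) <= sqn (w - crm K U w) &
      forall y, (K `&` U) y ->
        sqn (crm K U w - y) + sqn (w - crm K U w) <= sqn (w - y)].
Proof.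
move=> Uw; have [y0 [Ky0 Uy0]] := KU_neq0.
have pK : is_proj K w (Defs.proj K w) by apply: is_proj_proj => //; exists y0.
rewrite /crm_defined /crm /reflection.
set p := Defs.proj K w in pK *; set r := 2 *: p - w.
have qU : is_proj U r (Defs.proj U r).
  by apply: is_proj_proj; [exact: affine_set_closed | exists y0].
set q := Defs.proj U r in qU *; have [Uq _] := qU.
(* If [q = w] then [p - w] is orthogonal to the direction of [U], while a
   point [y0] of [K `&` U] satisfies
   [dot (y0 - w) (p - w) >= sqn (p - w)]. *)
have qw : q = w -> p = w.
  move=> qw; apply/eqP; rewrite -subr_eq0; apply/eqP/sqn_eq0.
  have := is_proj_affine U_affine qU Uy0 Uw; rewrite qw.
  have -> : r - w = 2 *: (p - w) by apply/rowP => i; rewrite !mxE; ring.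
  have := is_proj_convex K_convex pK Ky0.
  have -> : y0 - p = (y0 - w) - (p - w) by apply/rowP => i; rewrite !mxE; ring.
  rewrite -(opprB p w) dotNr dotDl dotNl dotZr => le0 eq0.
  have := sqn_ge0 (p - w); move: le0; rewrite /sqn; lra.
have [cP pc] := is_circumcenter_reflections (is_proj_affine U_affine qU Uq Uw) qw.
set t := 2 * _ / _ in cP pc.
have -> : circumcenter w r (2 *: q - r) = (1 - t) *: w + t *: q.
  exact: is_circumcenter_uniq (xgetPex _ (ex_intro _ _ cP)) cP.
set c := (1 - t) *: w + t *: q in cP pc *.
have Uc : U c by rewrite /c; exact: U_affine.
split=> //; first by exists c.
  (* Pythagoras in the right-angled triangle [w p c]. *)
  have := sqn_ge0 (p - c).
  have -> : w - c = (p - c) - (p - w) by apply/rowP => i; rewrite !mxE; ring.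
  have := sqn_subZ 1 (p - c) (p - w); rewrite scale1r dotC pc => ->.
  rewrite (sqn_sub w p); lra.
move=> y [Ky Uy].
(* [y - c] is a direction of [U], so [q - w] can be replaced by
   [r - w = 2 *: (p - w)] in its inner product. *)
have ycr : dot (y - c) (r - q) = 0 := is_proj_affine U_affine qU Uy Uc.
have yp := is_proj_convex K_convex pK Ky.
have ycw : dot (y - c) (q - w) >= 0.
  have -> : q - w = 2 *: (p - w) - (r - q) by apply/rowP => i; rewrite !mxE; ring.
  rewrite dotDr dotNr ycr dotZr.
  have -> : y - c = (y - p) + (p - c) by apply/rowP => i; rewrite !mxE; ring.
  rewrite dotDl pc; move: yp; rewrite -(opprB p w) dotNr; lra.
have t0 : 0 <= t by rewrite divr_ge0 ?mulr_ge0 ?sqn_ge0.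
have -> : w - c = - t *: (q - w) by apply/rowP => i; rewrite !mxE; ring.
have -> : w - y = (c - y) - t *: (q - w) by apply/rowP => i; rewrite !mxE; ring.
have dE : dot (q - w) (c - y) = - dot (y - c) (q - w) by rewrite dotC -dotNl opprB.
rewrite sqn_subZ dE {2}/sqn dotZl dotZr -/(sqn _).
have := mulr_ge0 t0 ycw; lra.
Qed.

Lemma crm_cvg z : U z ->
  [/\ forall k : nat, crm_defined K U (iter k (crm K U) z),
      forall k : nat, U (iter k (crm K U) z) &
      exists2 p : 'rV[R]_n, (K `&` U) p &
        (fun k : nat => iter k (crm K U) z) @ \oo --> p].
Proof.
move=> Uz; pose u k := iter k (crm K U) z.
have Uu k : U (u k) by elim: k => //= k /crm_spec[].
split=> // [k|]; first by have [] := crm_spec (Uu k).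
have fejer y k : (K `&` U) y ->
    sqn (u k.+1 - y) + sqn (u k - Defs.proj K (u k)) <= sqn (u k - y).
  move=> KUy; have [_ _ + /(_ _ KUy)] := crm_spec (Uu k); rewrite -/(u k.+1); lra.
have fejer' y k : (K `&` U) y -> sqn (u k.+1 - y) <= sqn (u k - y).
  move=> /(fejer _ k); have := sqn_ge0 (u k - Defs.proj K (u k)); lra.
have [y0 KUy0] := KU_neq0.
have ub k : sqn (u k - y0) <= sqn (z - y0).
  by elim: k => // k; exact/le_trans/fejer'.
have [x xu] := compact_seq_cluster (@compact_sqn_ball y0 (sqn (z - y0))) ub.
have Ux : U x.
  apply: closed_sqn (affine_set_closed U_affine) _ => e e0.
  by have [k _ ke] := xu _ 0%N e0; exists (u k).
have Kx : K x.
  apply: closed_sqn K_closed _ => e e0.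
  (* The projection of [u k] onto [K] is close to [u k] by the Fejer gap, and
     [u k] is close to [x]; each contributes twice a quarter of [e]. *)
  have e4 : 0 < e / 4 by rewrite divr_gt0.
  have [N uN] := antitone_gap (a := fun k => sqn (u k - y0)) e4
    (fun k => sqn_ge0 _) (fun k => fejer' _ k KUy0).
  have [k Nk ke] := xu _ N e4; exists (Defs.proj K (u k)).
    have [] // : is_proj K (u k) (Defs.proj K (u k)).
    by apply: is_proj_proj => //; exists y0; case: KUy0.
  have := uN _ Nk; have := fejer _ k KUy0.
  have := sqn_triangle (Defs.proj K (u k) - u k) (u k - x).
  rewrite addrA subrK (sqn_sub _ (u k)); lra.
by exists x => //; exact: fejer_cvg fejer' _ xu.
Qed.
End CRM.

End Euclidean.

Theorem theorem1 (R : realType) (n : nat) (K U : set 'rV[R]_n) (z : 'rV[R]_n)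
    (K_closed : closed K) (K_convex : @convex_set R 'rV[R]_n K)
    (U_affine : affine_set U) (KU_neq0 : K `&` U !=set0) (Uz : U z) :
  [/\ forall k : nat, crm_defined K U (iter k (crm K U) z),
      forall k : nat, U (iter k (crm K U) z) &
      exists2 p : 'rV[R]_n, (K `&` U) p &
        (fun k : nat => iter k (crm K U) z) @ \oo --> p].
Proof. exact: crm_cvg. Qed.
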